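(* Let $\mathfrak{B}$ be a 3-dimensional Bol algebra over $\mathbb{R}$ whose trilinear operation is of Type $V^+$ and whose canonical enveloping Lie algebra $\mathfrak{G}$ has dimension 4. Then $\mathfrak{B}$ is isotopic to one of the following Bol algebras with basis $e_1,e_2,e_3$: (i) $e_2\cdot e_3=-e_3$, $(e_2,e_3,e_2)=e_1$, $(e_2,e_3,e_3)=-e_2$; (ii) $e_2\cdot e_3=e_2$, $(e_2,e_3,e_2)=e_1$, $(e_2,e_3,e_3)=-e_2$; (iii) trivial (zero) bilinear operation, $(e_2,e_3,e_2)=e_1$, $(e_2,e_3,e_3)=-e_2$.
   Context: A Bol algebra over $\mathbb{R}$ is a real vector space $V$ with a bilinear operation $\xi\cdot\eta$ (also written $\xi\eta$) and a trilinear operation $(\xi,\eta,\zeta)$, skew-symmetric in its first two arguments, satisfying for all elements: (1) $\xi\cdot\xi=0$ and $(\xi,\eta,\zeta)+(\eta,\zeta,\xi)+(\zeta,\xi,\eta)=0$; (2) $(\xi,\eta,\zeta)\cdot\chi-(\xi,\eta,\chi)\cdot\zeta+(\zeta,\chi,\xi\cdot\eta)-(\xi,\eta,\zeta\cdot\chi)+(\xi\cdot\eta)\cdot(\zeta\cdot\chi)=0$; (3) $(\xi,\eta,(\zeta,\chi,\omega))=((\xi,\eta,\zeta),\chi,\omega)+(\zeta,(\xi,\eta,\chi),\omega)+(\zeta,\chi,(\xi,\eta,\omega))$. An enveloping pair of a Bol algebra $\mathfrak{B}$ is a pair $(\mathfrak{G},\mathfrak{h})$, where $\mathfrak{G}$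 is a finite-dimensional real Lie algebra containing $\mathfrak{B}$ as a vector subspace and $\mathfrak{h}$ is a Lie subalgebra of $\mathfrak{G}$, such that $\mathfrak{G}=\mathfrak{B}\dotplus\mathfrak{h}$ (direct sum of vector spaces), $[[\mathfrak{B},\mathfrak{B}],\mathfrak{B}]\subset\mathfrak{B}$, and for all $\xi,\eta,\zeta\in\mathfrak{B}$: $\xi\cdot\eta=[\xi,\eta]_{\mathfrak{B}}$ and $(\xi,\eta,\zeta)=[[\xi,\eta],\zeta]$, where $[\xi,\eta]_{\mathfrak{B}}$ is the projection of $[\xi,\eta]$ to $\mathfrak{B}$ parallel to $\mathfrak{h}$. The pair is canonical (and $\mathfrak{G}$ is the canonical enveloping Lie algebra of $\mathfrak{B}$) if $\mathfrak{G}=\mathfrak{B}+[\mathfrak{B},\mathfrak{B}]$ and $\mathfrak{h}$ contains no nonzero ideal of $\mathfrak{G}$. Isotopy: let $\mathfrak{B}$ and $\widetilde{\mathfrak{B}}$ be Bol algebras with canonical enveloping Lie algebras $\mathfrak{G}=\mathfrak{B}\dotplus\mathfrak{h}$ and $\widetilde{\mathfrak{G}}=\widetilde{\mathfrak{B}}\dotplus\widetilde{\mathfrak{h}}$. $\mathfrak{B}$ is isotopic to $\widetilde{\mathfrak{B}}$ if there is a Lie algebra isomorphism $\Phi:\mathfrak{G}\to\widetilde{\mathfrak{G}}$ with $\Phi(\mathfrak{B})=\widetilde{\mathfrak{B}}$ and $\Phi(\mathfrak{h})=(\mathrm{Ad}\,\xi)\,\widetilde{\mathfrak{h}}$ for some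 $\xi\in\widetilde{\mathfrak{G}}$, where $\mathrm{Ad}\,\xi=\exp(\mathrm{ad}\,\xi)$ is the inner automorphism defined by $\xi$. The trilinear operation of a 3-dimensional Bol algebra is of Type $V^+$ if there is a basis $e_1,e_2,e_3$ in which $(e_2,e_3,e_2)=e_1$ and $(e_2,e_3,e_3)=-e_2$, with all products $(e_i,e_j,e_k)$ not determined from these by skew-symmetry in the first two arguments equal to zero. In multiplication tables, products of basis vectors not determined from the listed ones by skew-symmetry ($e_j\cdot e_i=-e_i\cdot e_j$, $(e_j,e_i,e_k)=-(e_i,e_j,e_k)$) are zero. *)

(* Defs.v *)
From HB Require Import structures.
From mathcomp Require Import all_boot all_order all_algebra.
From mathcomp Require Import all_classical all_reals all_analysis.
Import numFieldNormedType.Exports.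

Set Implicit Arguments.
Unset Strict Implicit.
Unset Printing Implicit Defensive.

Import Order.TTheory GRing.Theory Num.Theory.
Local Open Scope ring_scope.

Record bolAlgebra (R : realType) (V : lmodType R) := BolAlgebra {
  bmul : V -> V -> V;
  btri : V -> V -> V -> V;
  bmul_linearl : forall y, linear (fun x => bmul x y);
  bmul_linearr : forall x, linear (bmul x);
  btri_linear1 : forall y z, linear (fun x => btri x y z);
  btri_linear2 : forall x z, linear (fun y => btri x y z);
  btri_linear3 : forall x y, linear (btri x y);
  btri_skew : forall x y z, btri x y z = - btri y x z;
  bmul_alt : forall x, bmul x x = 0;
  btri_cyclic : forall x y z, btri x y z + btri y z x + btri z x y = 0;
  bol_compat : forall x y z t,
    bmul (btri x y z) t - bmul (btri x y t) z + btri z t (bmul x y)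
      - btri x y (bmul z t) + bmul (bmul x y) (bmul z t) = 0;
  btri_derivation : forall x y z t w,
    btri x y (btri z t w) =
      btri (btri x y z) t w + btri z (btri x y t) w + btri z t (btri x y w) }.

Record lieAlgebra (R : realType) (G : lmodType R) := LieAlgebra {
  lie : G -> G -> G;
  lie_linearl : forall y, linear (fun x => lie x y);
  lie_linearr : forall x, linear (lie x);
  lie_alt : forall x, lie x x = 0;
  lie_jacobi : forall x y z,
    lie x (lie y z) + lie y (lie z x) + lie z (lie x y) = 0 }.

HB.instance Definition _ (R : realType) (G : lmodType R) (L : lieAlgebra G)
    (x : G) :=
  GRing.isLinear.Build R G G *:%R (lie L x) (lie_linearr L x).

Section LieNotions.
Context (R : realType) (G : vectType R) (L : lieAlgebra G).
Implicit Types (U W : {vspace G}).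

Definition ad (x : G) : 'End(G) := linfun (lie L x).

Lemma adE x y : ad x y = lie L x y.
Proof. by rewrite lfunE. Qed.

(* The linear span of the brackets [u, w], u in U, w in W. *)
Definition liev U W : {vspace G} :=
  <<[seq lie L u w | u <- vbasis U, w <- vbasis W]>>%VS.

Definition lie_subalgebra U : Prop :=
  forall x y, x \in U -> y \in U -> lie L x y \in U.

Definition lie_ideal U : Prop :=
  forall x y, y \in U -> lie L x y \in U.

End LieNotions.

Definition expmx (R : realType) (n : nat) (A : 'M[R]_n) : 'M[R]_n :=
  lim (series (fun k => k`!%:R^-1 *: A ^+ k) @ \oo)%classic.

(* A vectType carries no topology, so the exponential series is summed on
   matrices; the result does not depend on the basis. *)
Definition expEnd (R : realType) (G : vectType R) (f : 'End(G)) : 'End(G) :=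
  passmx.hommx (vbasis {:G}) (vbasis {:G})
    (expmx (passmx.mxof (vbasis {:G}) (vbasis {:G}) f)).

Definition Ad (R : realType) (G : vectType R) (L : lieAlgebra G) (x : G) :
  'End(G) := expEnd (ad L x).

(* The inclusion of the Bol algebra in the Lie algebra is an injective linear
   map [env_inj]. *)
Record envelopingPair (R : realType) (V : vectType R) (B : bolAlgebra V) :=
  EnvelopingPair {
  env_space : vectType R;
  env_lie : lieAlgebra env_space;
  env_inj : 'Hom(V, env_space);
  env_sub : {vspace env_space};
  env_inj_ker : lker env_inj = 0%VS;
  env_subalgebra : lie_subalgebra env_lie env_sub;
  env_direct : (limg env_inj :&: env_sub = 0)%VS;
  env_full : (limg env_inj + env_sub = fullv)%VS;
  env_triple :
    (liev env_lie (liev env_lie (limg env_inj) (limg env_inj)) (limg env_inj)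
      <= limg env_inj)%VS;
  env_mul : forall x y,
    env_inj (bmul B x y) =
      daddv_pi (limg env_inj) env_sub (lie env_lie (env_inj x) (env_inj y));
  env_tri : forall x y z,
    env_inj (btri B x y z) =
      lie env_lie (lie env_lie (env_inj x) (env_inj y)) (env_inj z) }.

Definition canonical_pair (R : realType) (V : vectType R) (B : bolAlgebra V)
    (E : envelopingPair B) : Prop :=
  (limg (env_inj E)
     + liev (env_lie E) (limg (env_inj E)) (limg (env_inj E)) = fullv)%VS /\
  (forall I : {vspace env_space E},
     lie_ideal (env_lie E) I -> (I <= env_sub E)%VS -> I = 0%VS).

Definition lie_isomorphism (R : realType) (G1 G2 : vectType R)
    (L1 : lieAlgebra G1) (L2 : lieAlgebra G2) (f : 'Hom(G1, G2)) : Prop :=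
  bijective f /\ forall x y, f (lie L1 x y) = lie L2 (f x) (f y).

(* A canonical enveloping pair is unique up to an isomorphism which is the
   identity on the Bol algebra, so isotopy does not depend on the choice of
   [E1] and [E2]. *)
Definition isotopic (R : realType) (V1 V2 : vectType R)
    (B1 : bolAlgebra V1) (B2 : bolAlgebra V2) : Prop :=
  exists (E1 : envelopingPair B1) (E2 : envelopingPair B2),
    [/\ canonical_pair E1, canonical_pair E2 &
    exists (Phi : 'Hom(env_space E1, env_space E2)) (x : env_space E2),
      [/\ lie_isomorphism (env_lie E1) (env_lie E2) Phi,
          (Phi @: limg (env_inj E1) = limg (env_inj E2))%VS &
          (Phi @: env_sub E1 = Ad (env_lie E2) x @: env_sub E2)%VS]].

Section Tables.
Context (R : realType) (V : vectType R) (B : bolAlgebra V).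

(* The trilinear operation is given in the basis e1, e2, e3 by
   (e2,e3,e2) = e1 and (e2,e3,e3) = -e2; only the products (e_i,e_j,e_k) with
   i < j have to be prescribed. *)
Definition tri_Vplus (e1 e2 e3 : V) : Prop :=
  [/\ btri B e2 e3 e1 = 0, btri B e2 e3 e2 = e1, btri B e2 e3 e3 = - e2,
      {in [:: e1; e2; e3], forall z, btri B e1 e2 z = 0} &
      {in [:: e1; e2; e3], forall z, btri B e1 e3 z = 0}].

Definition type_Vplus : Prop :=
  exists e1 e2 e3 : V, basis_of fullv [:: e1; e2; e3] /\ tri_Vplus e1 e2 e3.

(* The bilinear operation is given in the basis e1, e2, e3 by e2.e3 = v. *)
Definition mul_table (e1 e2 e3 v : V) : Prop :=
  [/\ bmul B e1 e2 = 0, bmul B e1 e3 = 0 & bmul B e2 e3 = v].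

Definition bol_i : Prop := exists e1 e2 e3 : V,
  [/\ basis_of fullv [:: e1; e2; e3], mul_table e1 e2 e3 (- e3) &
      tri_Vplus e1 e2 e3].

Definition bol_ii : Prop := exists e1 e2 e3 : V,
  [/\ basis_of fullv [:: e1; e2; e3], mul_table e1 e2 e3 e2 &
      tri_Vplus e1 e2 e3].

Definition bol_iii : Prop := exists e1 e2 e3 : V,
  [/\ basis_of fullv [:: e1; e2; e3], (forall x y, bmul B x y = 0) &
      tri_Vplus e1 e2 e3].

End Tables.

(* Main.v *)
Require Import Defs.
From mathcomp Require Import all_boot all_order all_algebra.
From mathcomp Require Import all_classical all_reals all_analysis.
From mathcomp Require Import ring.
Import numFieldNormedType.Exports.

Set Implicit Arguments.
Unset Strict Implicit.
Unset Printing Implicit Defensive.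

Import passmx Order.TTheory GRing.Theory Num.Theory.
Local Open Scope ring_scope.

(** Write T for the image of the Bol algebra in its envelope G, h for the given
subalgebra, and g4 = [e2, e3].  The triple products prescribe the adjoint action
of g4 on T, and the Jacobi identity then makes [e1, e2] and [e1, e3] central.
With g4 outside T and dim G = 4 this kills both of them, so G is the
oscillator algebra

  [e2, e3] = g4,   [g4, e2] = e1,   [g4, e3] = - e2,   e1 central

([lie_frame]): a Heisenberg algebra <e2, g4, e1> on which e3 acts as a rotation
of the plane <e2, g4> modulo e1.  The complement h is a line, spanned by some
k = a e1 + b e2 + c e3 + g4 ([env_sub_line]), and every line of this form
defines a Bol algebra with the same triple products ([line_bol]).  Hence it is
enough to move h to the line of one of the tables by some Ad x; the isomorphism
Phi of the two envelopes is then the identity ([isotopic_comp_bol]).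

Everything is done with one kind of inner automorphism.  If the e3-coordinate
of u is 1, then J = ad u satisfies J^3 = - J, whatever the other coordinates,
and summing the exponential series gives
exp (t J) = 1 + sin t J + (1 - cos t) J^2 ([Ad_rotation]): a rotation whose
centre depends on u.

- If c = 0, rotating <g4> in the plane <e2, g4> by the angle of b e2 + g4 yields
  the line of k; the choice of the centre adjusts the coordinate on e1
  ([isotopic_trivial]).  This leads to table (iii), whose complement is <g4>.
  The complement <g4 - e2> of table (ii) belongs to this orbit.
- If c <> 0, the changes of basis e1, e2, e3 -> s^2 e1, s e2, e3 + t e1 preserve
  the triple products ([tri_Vplus_rescale]) and achieve c = 1 and
  a = - b^2 / 2.  A half-turn with centre halfway between e3 + g4 and
  b e2 + e3 + g4 exchanges the two modulo e1, and the value of a is the one for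
  which the coordinates on e1 agree as well ([isotopic_i]).  This leads
  to table (i), whose complement is <e3 + g4>. *)

(** * The exponential of an endomorphism with J^3 = - J *)

Lemma exprmxZ (R : comPzRingType) n (a : R) (A : 'M[R]_n) k :
  (a *: A) ^+ k = a ^+ k *: A ^+ k.
Proof.
elim: k => [|k IHk]; first by rewrite !expr0 scale1r.
by rewrite !exprS IHk -[LHS]scalemxAl -[_ *m _]scalemxAr scalerA.
Qed.

Lemma exprmx_cube_opp (R : realType) n (A : 'M[R]_n) k : A ^+ 3 = - A ->
  (A ^+ k.*2.+1 = (-1) ^+ k *: A) * (A ^+ k.*2.+2 = (-1) ^+ k *: A ^+ 2).
Proof.
move=> A3; have odd_pow : A ^+ k.*2.+1 = (-1) ^+ k *: A.
  elim: k => [|k IHk]; first by rewrite !expr0 scale1r expr1.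
  rewrite doubleS -addn2 exprD IHk -[_ * _]scalemxAl mulmxE -exprS A3 exprS.
  by rewrite scalerN mulN1r scaleNr.
by split=> //; rewrite exprSr odd_pow -[_ * _]scalemxAl mulmxE -expr2.
Qed.

(** The odd powers of A are multiples of A and the positive even ones multiples of
A^2; they contribute the terms of sin t and of - cos t respectively. *)
Lemma expmx_rotation (R : realType) n (A : 'M[R]_n) (t : R) : A ^+ 3 = - A ->
  expmx (t *: A) = 1%:M + sin t *: A + (1 - cos t) *: A ^+ 2.
Proof.
move=> A3.
(* head makes up for A^0 = 1, where the pattern would give - A^2. *)
pose head k : 'M[R]_n := if k is 0 then 1%:M + A ^+ 2 else 0.
have termE k : k`!%:R^-1 *: (t *: A) ^+ k =
    head k + sin_coeff t k *: A - cos_coeff t k *: A ^+ 2.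
  rewrite exprmxZ scalerA [_^-1 * _]mulrC.
  have := odd_double_half k; case: (odd k) => /= <-.
    rewrite add1n (exprmx_cube_opp _ A3).1 /sin_coeff /cos_coeff /=.
    rewrite odd_double /= !mul0r scale0r add0r subr0 scalerA doubleK.
    by congr (_ *: _); rewrite mul1r mulrC mulrA.
  case: k./2 => [|m]; rewrite /= add0n.
    rewrite /sin_coeff /cos_coeff /= fact0 !expr0 invr1 expr0z !mul1r !mulr1.
    by rewrite scale0r !scale1r addr0 addrK.
  rewrite doubleS (exprmx_cube_opp _ A3).2 /sin_coeff /cos_coeff /=.
  rewrite negbK odd_double /= !mul0r scale0r !add0r -scaleNr scalerA doubleK.
  by congr (_ *: _); rewrite mul1r -exprnP [(-1) ^+ _.+1]exprS mulN1r
    !mulNr opprK mulrC mulrA.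
have headE : (series head @ \oo --> 1%:M + A ^+ 2)%classic.
  apply: cvg_near_cst; exists 1%N => //= -[|m] //= _.
  by rewrite /series /= big_nat_recl //= big1 ?addr0.
have seriesE : series (fun k => k`!%:R^-1 *: (t *: A) ^+ k) =
    (fun m => series head m + series (sin_coeff t) m *: A
       - series (cos_coeff t) m *: A ^+ 2).
  apply/funext=> m; rewrite /series /= (eq_bigr _ (fun k _ => termE k)).
  by rewrite big_split big_split sumrN /= !scaler_suml.
have -> : 1%:M + sin t *: A + (1 - cos t) *: A ^+ 2 =
    1%:M + A ^+ 2 + sin t *: A - cos t *: A ^+ 2.
  by rewrite scalerBl scale1r addrA [1%:M + _ + A ^+ 2]addrAC.
rewrite /expmx seriesE; apply: cvg_lim; first exact: norm_hausdorff.
apply: cvgB; first apply: cvgD => //.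
  by apply: cvgZr_tmp; rewrite sin.unlock; exact: is_cvg_series_sin_coeff.
by apply: cvgZr_tmp; rewrite cos.unlock; exact: is_cvg_series_cos_coeff.
Qed.

Lemma expEnd_rotation (R : realType) (G : vectType R) (J : 'End(G)) (t : R) :
  (forall y, J (J (J y)) = - J y) ->
  forall y, expEnd (t *: J) y = y + sin t *: J y + (1 - cos t) *: J (J y).
Proof.
move=> J3 y; have bG := vbasisP {:G}; set b := vbasis _ in bG.
pose M := mxof b b J; have M2 : mxof b b (J \o J)%VF = M ^+ 2.
  exact: mxof_comp.
have M3 : M ^+ 3 = - M.
  rewrite exprS -M2 -[_ * _](mxof_comp _ _ bG) /M -linearN.
  by congr mxof; apply/lfunP=> x; rewrite !lfunE /= lfunE /= J3.
rewrite /expEnd -/b linearZ /= -/M expmx_rotation // -M2.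
rewrite !linearD !linearZ /= !(mxofK bG bG) (hommx1 bG).
by do !rewrite lfunE /=.
Qed.

(** * Calculus with brackets *)

Section LinearFunctions.
Context (R : pzRingType) (U V : lmodType R) (f : U -> V) (linf : linear f).

Lemma linear_funD x y : f (x + y) = f x + f y.
Proof. by have := linf 1 x y; rewrite !scale1r. Qed.

Lemma linear_fun0 : f 0 = 0.
Proof. by apply: (addrI (f 0)); rewrite -linear_funD !addr0. Qed.

Lemma linear_funZ a x : f (a *: x) = a *: f x.
Proof. by have := linf a x 0; rewrite linear_fun0 !addr0. Qed.

Lemma linear_funN x : f (- x) = - f x.
Proof. by rewrite -scaleN1r linear_funZ scaleN1r. Qed.

End LinearFunctions.

Section LieCalculus.
Context (R : realType) (G : lmodType R) (L : lieAlgebra G).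

Definition lieDl x y z := linear_funD (lie_linearl L z) x y.
Definition lieZl a x z := linear_funZ (lie_linearl L z) a x.
Definition lieNl x z := linear_funN (lie_linearl L z) x.
Definition lie0l z := linear_fun0 (lie_linearl L z).
Definition lieDr x := linear_funD (lie_linearr L x).
Definition lieZr x := linear_funZ (lie_linearr L x).
Definition lieNr x := linear_funN (lie_linearr L x).
Definition lie0r x := linear_fun0 (lie_linearr L x).

Lemma lie_anti x y : lie L x y = - lie L y x.
Proof.
apply/eqP; rewrite -subr_eq0 opprK; apply/eqP.
by have := lie_alt L (x + y); rewrite lieDl !lieDr !lie_alt addr0 add0r.
Qed.

Lemma lie_leibniz x y z :
  lie L x (lie L y z) = lie L (lie L x y) z + lie L y (lie L x z).
Proof.
have /eqP := lie_jacobi L x y z.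
rewrite (lie_anti z (lie L x y)) (lie_anti z x) lieNr.
by rewrite -addrA -opprD subr_eq0 addrC => /eqP.
Qed.

End LieCalculus.

Section Lines.
Context (R : realType) (G : vectType R) (L : lieAlgebra G).

Lemma lie_subalgebra_line k : lie_subalgebra L <[k]>%VS.
Proof.
move=> _ _ /vlineP[a ->] /vlineP[b ->].
by rewrite lieZl lieZr lie_alt !scaler0 mem0v.
Qed.

Lemma lineZ (a : R) (k : G) : a != 0 -> <[a *: k]>%VS = <[k]>%VS.
Proof.
move=> a0; apply/eqP; rewrite eqEsubv -!memvE memvZ ?memv_line //=.
by rewrite -{1}[k]scale1r -(mulVf a0) -scalerA memvZ ?memv_line.
Qed.

End Lines.

(** * Changing the complement in an enveloping pair *)

Section ChangeOfComplement.
Context (R : realType) (V : vectType R) (B : bolAlgebra V).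
Context (E : envelopingPair B) (h : {vspace env_space E}).
Local Notation L := (env_lie E).
Local Notation i := (env_inj E).
Local Notation T := (limg i).
Hypotheses (h_subalgebra : lie_subalgebra L h).
Hypotheses (h_direct : (T :&: h = 0)%VS) (h_full : (T + h = fullv)%VS).

Lemma env_injI : injective i.
Proof. by apply/lker0P; rewrite env_inj_ker. Qed.

Lemma env_mem x : i x \in T.
Proof. exact: memv_img (memvf x). Qed.

Let p := daddv_pi T h.

Let p_id x : p (i x) = i x.
Proof. exact: daddv_pi_id (env_mem x). Qed.

Let p_mod w : w - p w \in h.
Proof.
have wTh : w \in (T + h)%VS by rewrite h_full memvf.
have e := daddv_pi_add h_direct wTh.
by rewrite -{1}e addrC addKr memv_pi.
Qed.

Let p_ker w : w \in h -> p w = 0.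
Proof.
move=> hw; have hT0 : (h :&: T = 0)%VS by rewrite capvC.
have wTh : w \in (T + h)%VS by rewrite h_full memvf.
have := daddv_pi_add h_direct wTh; rewrite (daddv_pi_id hT0 hw).
by move/(canRL (addrK _)); rewrite subrr.
Qed.

(** The binary product read off from the complement h instead of [env_sub E]. *)
Definition comp_mul x y : V := (i^-1)%VF (p (lie L (i x) (i y))).

Lemma comp_mulE x y : i (comp_mul x y) = p (lie L (i x) (i y)).
Proof. by rewrite limg_lfunVK ?memv_pi. Qed.

Lemma comp_mul_mod x y v : lie L (i x) (i y) - i v \in h -> comp_mul x y = v.
Proof.
move=> /p_ker; rewrite linearB /= p_id => /subr0_eq e.
by apply: env_injI; rewrite comp_mulE.
Qed.

Lemma comp_mul_linearl y : linear (fun x => comp_mul x y).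
Proof.
move=> a u v; rewrite /comp_mul linearP /= lie_linearl.
by rewrite !linearP.
Qed.

Lemma comp_mul_linearr x : linear (comp_mul x).
Proof. by move=> a u v; rewrite /comp_mul linearP /= lie_linearr !linearP. Qed.

Lemma comp_mul_alt x : comp_mul x x = 0.
Proof. by rewrite /comp_mul lie_alt !linear0. Qed.

(** With P = [x, y] and Q = [z, t], the left-hand side is the projection to T of
the bracket of the h-components of P and Q, which lies in h. *)
Lemma comp_bol_compat x y z t :
  comp_mul (btri B x y z) t - comp_mul (btri B x y t) z
    + btri B z t (comp_mul x y) - btri B x y (comp_mul z t)
    + comp_mul (comp_mul x y) (comp_mul z t) = 0.
Proof.
apply: env_injI; rewrite !linearD !linearN linear0 /= !comp_mulE.
(* Both triple products lie in T, so they may be put under the projection. *)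
rewrite -[i (btri B z t _)]p_id -[i (btri B x y (comp_mul _ _))]p_id.
rewrite !env_tri !comp_mulE.
set X := i x; set Y := i y; set Z := i z; set S := i t.
set P := lie L X Y; set Q := lie L Z S.
have pD u v : p u + p v = p (u + v) by rewrite linearD.
have pB u v : p u - p v = p (u - v) by rewrite linearB.
rewrite !(pD, pB).
have -> : lie L (lie L P Z) S - lie L (lie L P S) Z = lie L P Q.
  by rewrite [RHS]lie_leibniz [lie L Z _]lie_anti.
suff -> : lie L P Q + lie L Q (p P) - lie L P (p Q) + lie L (p P) (p Q)
          = lie L (P - p P) (Q - p Q) by apply/p_ker/h_subalgebra; exact: p_mod.
rewrite lieDl !lieDr !lieNl !lieNr opprK (lie_anti L Q).
by rewrite !addrA [lie L P Q - _ - _]addrAC.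
Qed.

Definition comp_bol : bolAlgebra V :=
  BolAlgebra comp_mul_linearl comp_mul_linearr (btri_linear1 B)
    (btri_linear2 B) (btri_linear3 B) (btri_skew B) comp_mul_alt
    (btri_cyclic B) comp_bol_compat (btri_derivation B).

Definition comp_pair : envelopingPair comp_bol :=
  @EnvelopingPair R V comp_bol (env_space E) L i h (env_inj_ker E)
    h_subalgebra h_direct h_full (env_triple E) comp_mulE (env_tri E).

(** Both Bol algebras are embedded in the same way in the same Lie algebra, so the
identity is an isomorphism of the envelopes. *)
Lemma isotopic_comp_bol (x : env_space E) :
  canonical_pair E ->
  (forall I : {vspace env_space E}, lie_ideal L I -> (I <= h)%VS -> I = 0%VS) ->
  (Ad L x @: h = env_sub E)%VS ->
  isotopic B comp_bol.
Proof.
move=> canE h_core conj; exists E, comp_pair.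
split; [exact: canE | by split=> //; exact: canE.1 | exists \1%VF, x].
split; [split | exact: lim1g | by rewrite lim1g /= conj].
- by exists id => y; rewrite lfunE.
- by move=> y z; rewrite !lfunE.
Qed.

End ChangeOfComplement.

(** * Triple products of type V+ *)

Section Triples.
Context (R : realType) (V : vectType R) (x y z : V).

Lemma basis3_span v : basis_of fullv [:: x; y; z] ->
  exists a b c, v = a *: x + b *: y + c *: z.
Proof.
move=> /span_basis full; have: v \in <<[:: x; y; z]>>%VS by rewrite full memvf.
rewrite !span_cons span_nil addv0 => /memv_addP[_ /vlineP[a ->]].
move=> [_ /memv_addP[_ /vlineP[b ->] [_ /vlineP[c ->] ->]] ->].
by exists a, b, c; rewrite addrA.
Qed.

Lemma basis3_coord0 a b c : basis_of fullv [:: x; y; z] ->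
  a *: x + b *: y + c *: z = 0 -> [/\ a = 0, b = 0 & c = 0].
Proof.
move=> /basis_free/(@freeP _ _ _ (in_tuple [:: x; y; z])) free e.
have := free (fun j => [:: a; b; c]`_j).
rewrite !big_ord_recl big_ord0 /= addr0 addrA => /(_ e) k0.
pose o1 : 'I_3 := lift ord0 ord0; pose o2 : 'I_3 := lift ord0 (lift ord0 ord0).
by split; [exact: (k0 ord0) | exact: (k0 o1) | exact: (k0 o2)].
Qed.

Lemma basis3_of_gen : \dim {:V} = 3%N ->
  (forall v, exists a b c, v = a *: x + b *: y + c *: z) ->
  basis_of fullv [:: x; y; z].
Proof.
move=> dimV gen; rewrite basisEdim dimV andbT; apply/subvP => v _.
have [a [b [c ->]]] := gen v.
by rewrite !memvD ?memvZ ?memv_span ?inE ?eqxx ?orbT.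
Qed.

End Triples.

Section TripleSystem.
Context (R : realType) (V : vectType R) (B : bolAlgebra V).

Definition btriZ1 a x z t := linear_funZ (btri_linear1 B z t) a x.
Definition btriD2 x y z t := linear_funD (btri_linear2 B z t) x y.
Definition btriZ2 a x z t := linear_funZ (btri_linear2 B z t) a x.
Definition btriD3 z t := linear_funD (btri_linear3 B z t).
Definition btriZ3 z t := linear_funZ (btri_linear3 B z t).

Lemma btri_alt x z : btri B x x z = 0.
Proof.
have /eqP := btri_skew B x x z; rewrite -subr_eq0 opprK -mulr2n -scaler_nat.
by rewrite scaler_eq0 pnatr_eq0 => /eqP.
Qed.

Context (e1 e2 e3 : V) (base : basis_of fullv [:: e1; e2; e3]).
Context (tri : tri_Vplus B e1 e2 e3).

Lemma tri_Vplus0 v : (btri B e1 e2 v = 0) * (btri B e1 e3 v = 0).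
Proof.
case: tri => _ _ _ z12 z13; have [a [b [c ->]]] := basis3_span v base.
by rewrite !(btriD3, btriZ3) !(z12, z13) ?inE ?eqxx ?orbT // !scaler0 !addr0.
Qed.

(** A two-parameter group of automorphisms of the triple system, written as
changes of basis. *)
Lemma tri_Vplus_rescale (s t : R) :
  \dim {:V} = 3%N -> s != 0 ->
  let f1 := s ^+ 2 *: e1 in let f2 := s *: e2 in let f3 := e3 + t *: e1 in
  basis_of fullv [:: f1; f2; f3] /\ tri_Vplus B f1 f2 f3.
Proof.
move=> dimV s0 f1 f2 f3; split.
  apply: basis3_of_gen => // v; have [a [b [c ->]]] := basis3_span v base.
  exists ((a - c * t) / s ^+ 2), (b / s), c.
  rewrite !scalerA !divfK ?expf_neq0 // scalerDr scalerA scalerBl.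
  by rewrite [c *: e3 + _]addrC addrA [a *: e1 - _ + _]addrAC subrK.
case: tri => t1 t2 t3 _ _.
have f23 v : btri B f2 f3 v = s *: btri B e2 e3 v.
  rewrite btriZ1 btriD2 btriZ2 [btri B e2 e1 v]btri_skew tri_Vplus0.
  by rewrite oppr0 scaler0 addr0.
split; rewrite ?f23.
- by rewrite btriZ3 t1 !scaler0.
- by rewrite btriZ3 t2 scalerA -expr2.
- by rewrite btriD3 btriZ3 t1 t3 scaler0 addr0 scalerN.
- by move=> v _; rewrite btriZ1 btriZ2 tri_Vplus0 !scaler0.
- move=> v _.
  by rewrite btriZ1 btriD2 btriZ2 btri_alt tri_Vplus0 !(scaler0, addr0).
Qed.

End TripleSystem.

(** * The four-dimensional envelope *)

Section Envelope.
Context (R : realType) (V : vectType R) (B : bolAlgebra V).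
Context (E : envelopingPair B) (e1 e2 e3 : V).
Local Notation L := (env_lie E).
Local Notation i := (env_inj E).
Local Notation T := (limg i).

(** Coordinates in e1, e2, e3, g4 = [e2, e3]; vector identities in G become
identities between real coordinates. *)
Definition frame (a b c d : R) : env_space E :=
  i (a *: e1 + b *: e2 + c *: e3) + d *: lie L (i e2) (i e3).

Lemma frameD a b c d a' b' c' d' :
  frame a b c d + frame a' b' c' d' = frame (a + a') (b + b') (c + c') (d + d').
Proof.
rewrite /frame addrACA -linearD -scalerDl; congr (i _ + _).
by rewrite !scalerDl addrACA [X in X + _]addrACA.
Qed.

Lemma frameZ s a b c d :
  s *: frame a b c d = frame (s * a) (s * b) (s * c) (s * d).
Proof. by rewrite /frame scalerDr -linearZ !scalerDr !scalerA. Qed.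

Lemma frameN a b c d : - frame a b c d = frame (- a) (- b) (- c) (- d).
Proof. by rewrite -scaleN1r frameZ !mulN1r. Qed.

Lemma frame0 : frame 0 0 0 0 = 0.
Proof. by rewrite /frame !scale0r !addr0 linear0. Qed.
Lemma frame1 : i e1 = frame 1 0 0 0.
Proof. by rewrite /frame !scale0r scale1r !addr0. Qed.
Lemma frame2 : i e2 = frame 0 1 0 0.
Proof. by rewrite /frame !scale0r scale1r !addr0 add0r. Qed.
Lemma frame3 : i e3 = frame 0 0 1 0.
Proof. by rewrite /frame !scale0r scale1r !addr0 !add0r. Qed.
Lemma frame4 : lie L (i e2) (i e3) = frame 0 0 0 1.
Proof. by rewrite /frame !scale0r scale1r !addr0 linear0 add0r. Qed.

Lemma frame_mem a b c : frame a b c 0 \in T.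
Proof. by rewrite /frame scale0r addr0 env_mem. Qed.

Hypothesis base : basis_of fullv [:: e1; e2; e3].

Lemma frame_imgP w : w \in T -> exists a b c, w = frame a b c 0.
Proof.
move=> /memv_imgP[v _ ->]; have [a [b [c ->]]] := basis3_span v base.
by exists a, b, c; rewrite /frame scale0r addr0.
Qed.

Hypothesis tri : tri_Vplus B e1 e2 e3.
Let g4 := lie L (i e2) (i e3).

Let g4E v : lie L g4 (i v) = i (btri B e2 e3 v).
Proof. by rewrite env_tri. Qed.

(** An element acting trivially on T also commutes with g4, a bracket of elements
of T. *)
Let bracket_central x y (q := lie L (i x) (i y)) :
  (forall v, btri B x y v = 0) ->
  (forall v, lie L q (i v) = 0) * (lie L q g4 = 0).
Proof.
move=> xy0; have q0 v : lie L (lie L (i x) (i y)) (i v) = 0.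
  by rewrite -env_tri xy0 linear0.
by split=> //; rewrite /g4 lie_leibniz !q0 lie0l lie0r addr0.
Qed.

Let c12 := bracket_central (fun v => (tri_Vplus0 base tri v).1).
Let c13 := bracket_central (fun v => (tri_Vplus0 base tri v).2).

Let tri_e : (btri B e2 e3 e1 = 0) * (btri B e2 e3 e2 = e1)
  * (btri B e2 e3 e3 = - e2).
Proof. by case: tri. Qed.

(** Suppose g4 = a e1 + b e2 + c e3.  Bracketing with e3 gives
- e2 = a [e1, e3] + b g4, where [e1, e3] is central; bracketing this with e2
forces b = 0, so e2 is central and g4 = [e2, e3] = 0, against [g4, e2] = e1. *)
Lemma g4_notin : g4 \notin T.
Proof.
apply/negP=> /frame_imgP[a [b [c g4F]]].
have g4L w : lie L g4 w =
    a *: lie L (i e1) w + b *: lie L (i e2) w + c *: lie L (i e3) w.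
  by rewrite g4F /frame scale0r addr0 !linearD !linearZ /= !(lieDl, lieZl).
have e1_neq0 : i e1 <> 0.
  move=> i0.
  have /(basis3_coord0 base)[/eqP] : 1 *: e1 + 0 *: e2 + 0 *: e3 = 0.
    by apply: (@env_injI _ _ _ E); rewrite !scale0r !addr0 scale1r i0 linear0.
  by rewrite oner_eq0.
have b0 : b = 0.
  have := g4L (i e3); rewrite lie_alt scaler0 addr0 g4E tri_e.
  rewrite -/g4 => /(congr1 (fun w => lie L w (i e2))).
  rewrite lieDl !lieZl c13 g4E tri_e linearN lieNl lie_alt oppr0 scaler0 add0r.
  by move/esym/eqP; rewrite scaler_eq0 => /orP[/eqP //|/eqP /e1_neq0].
have := g4L (i e3); rewrite lie_alt scaler0 addr0 b0 scale0r addr0.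
rewrite g4E tri_e linearN => /(congr1 (fun w => - lie L w (i e3))).
rewrite lieZl c13 scaler0 oppr0 lieNl opprK => g40; apply: e1_neq0.
by have := g4E e2; rewrite /g4 g40 lie0l tri_e => <-.
Qed.

Lemma frame_coord0 a b c d :
  frame a b c d = 0 -> [/\ a = 0, b = 0, c = 0 & d = 0].
Proof.
move=> f0; suff d0 : d = 0.
  move: f0; rewrite d0 /frame scale0r addr0 -(linear0 i) => /env_injI.
  by case/(basis3_coord0 base).
apply/eqP/negPn/negP => dn0; case/negP: g4_notin.
move: f0; rewrite /frame addrC => /eqP; rewrite addr_eq0 => /eqP f0.
rewrite -[g4]scale1r -(mulVf dn0) -scalerA f0.
by rewrite memvZ // memvN env_mem.
Qed.

Hypothesis dimV : \dim {:V} = 3%N.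
Hypothesis dimG : \dim {:env_space E} = 4%N.

Lemma frame_span w : exists a b c d, w = frame a b c d.
Proof.
have g4n0 : g4 != 0 by apply: contraNneq g4_notin => ->; exact: mem0v.
have disj : (T :&: <[g4]> = 0)%VS.
  apply/eqP; rewrite -subv0; apply/subvP=> v; rewrite memv_cap memv0.
  case/andP=> vT /vlineP[d v_g4]; rewrite v_g4 in vT *.
  have [->|dn0] := eqVneq d 0; first by rewrite scale0r.
  case/negP: g4_notin.
  by rewrite -[g4]scale1r -(mulVf dn0) -scalerA memvZ.
have full : (T + <[g4]> = fullv)%VS.
  apply/eqP; rewrite eqEdim subvf dimv_disjoint_sum // dim_vline g4n0.
  by rewrite limg_dim_eq ?env_inj_ker ?capv0 // dimV dimG.
have : w \in (T + <[g4]>)%VS by rewrite full memvf.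
case/memv_addP=> u /frame_imgP[a [b [c ->]]] [_ /vlineP[d ->] ->].
exists a, b, c, d; rewrite /g4 frame4 frameZ frameD.
by rewrite !(mulr0, mulr1, addr0, add0r).
Qed.

(** Bracketing with g4 reads off the coordinates on e2 and e3. *)
Let central_span q : (forall v, lie L q (i v) = 0) * (lie L q g4 = 0) ->
  exists a d, q = frame a 0 0 d.
Proof.
have [a [b [c [d ->]]]] := frame_span q; case=> _ /(congr1 -%R).
rewrite -lie_anti oppr0 /frame lieDr lieZr lie_alt scaler0 addr0 g4E.
rewrite !(btriD3, btriZ3) !tri_e scaler0 add0r.
rewrite -[RHS](linear0 i) => /env_injI e.
have [|b0 c0 _] := basis3_coord0 (a := b) (b := - c) (c := 0) base.
  by rewrite scale0r addr0 -e scalerN scaleNr.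
by exists a, d; rewrite b0 -[c]opprK c0 oppr0 !scale0r !addr0.
Qed.

(** By centrality p = [e1, e2] equals a e1 + d g4, and [p, e2] = a p + d e1 = 0
gives a^2 + d = 0 and a d = 0; the argument for [e1, e3] is the same. *)
Lemma lie_frame12 : lie L (i e1) (i e2) = 0.
Proof.
have [a [d pE]] := central_span c12.
suff [a0 d0] : a = 0 /\ d = 0 by rewrite pE a0 d0 frame0.
have := c12.1 e2.
rewrite {1}pE /frame !scale0r !addr0 linearZ lieDl !lieZl pE frameZ.
rewrite -/g4 g4E tri_e.
rewrite frame1 frameZ frameD !(mulr0, mulr1, addr0).
case/frame_coord0 => aad _ _ /eqP; rewrite mulf_eq0 => /orP[] /eqP z0.
  by move: aad; rewrite z0 mulr0 add0r.
by move: aad; rewrite z0 addr0 => /eqP; rewrite mulf_eq0 orbb => /eqP.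
Qed.

Lemma lie_frame13 : lie L (i e1) (i e3) = 0.
Proof.
have [a [d qE]] := central_span c13.
suff [a0 d0] : a = 0 /\ d = 0 by rewrite qE a0 d0 frame0.
have := c13.1 e3.
rewrite {1}qE /frame !scale0r !addr0 linearZ lieDl !lieZl qE frameZ.
rewrite -/g4 g4E tri_e.
rewrite (linearN i) /= frame2 frameN !frameZ frameD.
rewrite !(mulr0, mulr1, addr0, add0r, oppr0, mulrN).
case/frame_coord0 => /eqP a0 /eqP d0 _ _.
by move: a0 d0; rewrite mulf_eq0 orbb oppr_eq0 => /eqP -> /eqP ->.
Qed.

Lemma lie_frame a b c d a' b' c' d' :
  lie L (frame a b c d) (frame a' b' c' d') =
  frame (d * b' - b * d') (c * d' - d * c') 0 (b * c' - c * b').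
Proof.
have L1 w : lie L (i e1) w = 0.
  have [x [y [z [t ->]]]] := frame_span w.
  rewrite /frame !linearD !linearZ /= lie_alt.
  rewrite lie_frame12 lie_frame13 (lie_anti L (i e1)) -/g4 g4E tri_e.
  by rewrite (linear0 i) oppr0 !scaler0 !addr0.
have lieE x y z t w : lie L (frame x y z t) w =
    y *: lie L (i e2) w + z *: lie L (i e3) w + t *: lie L g4 w.
  by rewrite /frame !linearD !linearZ /= !lieDl !lieZl L1 scaler0 add0r.
have g4F : g4 = frame 0 0 0 1 := frame4.
have L2 : lie L (i e2) (frame a' b' c' d') = frame (- d') 0 0 c'.
  rewrite lie_anti lieE lie_alt (lie_anti L (i e3)) -/g4 g4E tri_e g4F frame1.
  by rewrite scaler0 add0r !(frameN, frameZ, frameD); congr frame; ring.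
have L3 : lie L (i e3) (frame a' b' c' d') = frame 0 d' 0 (- b').
  rewrite lie_anti lieE lie_alt -/g4 g4E tri_e g4F (linearN i) /= frame2.
  by rewrite scaler0 addr0 !(frameN, frameZ, frameD); congr frame; ring.
have L4 : lie L g4 (frame a' b' c' d') = frame b' (- c') 0 0.
  rewrite lie_anti lieE lie_alt !(lie_anti L _ g4) !g4E !tri_e.
  rewrite (linearN i) /= frame1 frame2.
  by rewrite scaler0 addr0 !(frameN, frameZ, frameD); congr frame; ring.
by rewrite lieE L2 L3 L4 !(frameZ, frameD); congr frame; ring.
Qed.

(** * Complements and the Bol algebras they define *)

Lemma line_direct a b c : (T :&: <[frame a b c 1]> = 0)%VS.
Proof.
apply/eqP; rewrite -subv0; apply/subvP=> v; rewrite memv_cap memv0.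
case/andP=> /frame_imgP[x [y [z ->]]] /vlineP[d].
move/eqP; rewrite frameZ -subr_eq0 frameN frameD => /eqP/frame_coord0[].
rewrite mulr1 add0r => ex ey ez /eqP; rewrite oppr_eq0 => /eqP d0.
move: ex ey ez; rewrite d0 !mul0r oppr0 !addr0 => -> -> ->.
by rewrite frame0.
Qed.

Lemma line_full a b c : (T + <[frame a b c 1]> = fullv)%VS.
Proof.
apply/eqP; rewrite eqEsubv subvf; apply/subvP=> w _.
have [x [y [z [d ->]]]] := frame_span w.
have -> : frame x y z d =
    frame (x - d * a) (y - d * b) (z - d * c) 0 + d *: frame a b c 1.
  by rewrite frameZ frameD; congr frame; ring.
by rewrite memv_add ?frame_mem // memvZ // memv_line.
Qed.

(** With k spanning the line, [e3, k] = e2 - b g4 is never a multiple n k: the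
coordinates on e2 and g4 would give 1 = n b and n = - b. *)
Lemma line_core a b c (I : {vspace env_space E}) :
  lie_ideal L I -> (I <= <[frame a b c 1]>)%VS -> I = 0%VS.
Proof.
move=> idI /subvP subI; apply/eqP; rewrite -subv0; apply/subvP=> v vI.
rewrite memv0; have /vlineP[m vE] := subI _ vI.
have /subI/vlineP[n] := idI (i e3) v vI.
rewrite vE frame3 !frameZ lie_frame => /eqP.
rewrite -subr_eq0 frameN frameD => /eqP/frame_coord0[_ e2E _ e4E].
suff -> : m = 0 by rewrite !mul0r frame0.
have eq1 : m - n * b = 0 by rewrite -[RHS]e2E; ring.
have eq2 : n + m * b = 0 by rewrite -[RHS]oppr0 -[in RHS]e4E; ring.
have : m * (1 + b ^+ 2) = (m - n * b) + (n + m * b) * b by ring.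
rewrite eq1 eq2 mul0r addr0.
move/eqP; rewrite mulf_eq0 => /orP[/eqP //|].
by rewrite gt_eqF // ltr_pwDl ?sqr_ge0.
Qed.

(** The h-component k of g4 has g4-coordinate 1, and subtracting from w in h the
multiple of k with the same g4-coordinate leaves an element of T and h. *)
Lemma env_sub_line : exists a b c, env_sub E = <[frame a b c 1]>%VS.
Proof.
have : g4 \in (T + env_sub E)%VS by rewrite env_full memvf.
case/memv_addP=> _ /frame_imgP[a [b [c ->]]] [k kh g4D].
have kE : k = frame (- a) (- b) (- c) 1.
  apply: (addrI (frame a b c 0)); rewrite -g4D frameD !subrr add0r.
  exact: frame4.
exists (- a), (- b), (- c); rewrite -kE.
apply/eqP; rewrite eqEsubv -memvE kh andbT; apply/subvP=> w wh.
have [x [y [z [d wE]]]] := frame_span w.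
suff : w - d *: k \in (T :&: env_sub E)%VS.
  by rewrite env_direct memv0 subr_eq0 => /eqP ->; rewrite memvZ ?memv_line.
have -> : (w - d *: k \in T :&: env_sub E)%VS = (w - d *: k \in T).
  by rewrite memv_cap [w - _ \in env_sub E]memvB ?memvZ ?andbT.
rewrite wE kE frameZ frameN frameD.
by rewrite mulr1 subrr frame_mem.
Qed.

Definition line_bol a b c : bolAlgebra V :=
  comp_bol (@lie_subalgebra_line _ _ L (frame a b c 1)) (line_direct a b c)
    (line_full a b c).

Lemma line_bol_mul a b c x y d :
  lie L (i x) (i y) = d *: g4 ->
  bmul (line_bol a b c) x y = - d *: (a *: e1 + b *: e2 + c *: e3).
Proof.
move=> xy; apply: (comp_mul_mod (line_direct a b c) (line_full a b c)).
rewrite xy scaleNr linearN opprK linearZ /=.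
by rewrite -scalerDr addrC -[g4]scale1r memvZ ?memv_line.
Qed.

Lemma line_bol_table a b c :
  mul_table (line_bol a b c) e1 e2 e3 (- (a *: e1 + b *: e2 + c *: e3)).
Proof.
split.
- by rewrite (@line_bol_mul _ _ _ _ _ 0) ?lie_frame12 ?oppr0 !scale0r.
- by rewrite (@line_bol_mul _ _ _ _ _ 0) ?lie_frame13 ?oppr0 !scale0r.
- by rewrite (@line_bol_mul _ _ _ _ _ 1) ?scaleN1r // scale1r.
Qed.

Lemma line_bol0_mul x y : bmul (line_bol 0 0 0) x y = 0.
Proof.
have [a [b [c ->]]] := basis3_span x base.
have [a' [b' [c' ->]]] := basis3_span y base.
rewrite (@line_bol_mul _ _ _ _ _ (b * c' - c * b')).
  by rewrite !scale0r !addr0 scaler0.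
have in_frame u v w : i (u *: e1 + v *: e2 + w *: e3) = frame u v w 0.
  by rewrite /frame scale0r addr0.
rewrite !in_frame lie_frame !(mul0r, mulr0, subr0) /frame !scale0r !addr0.
by rewrite linear0 add0r.
Qed.

(** * Moving complements by inner automorphisms *)

Lemma Ad_rotation x y z t w : let u := frame x y 1 z in
  Ad L (t *: u) w = w + sin t *: lie L u w + (1 - cos t) *: lie L u (lie L u w).
Proof.
move=> u; have -> : Ad L (t *: u) = expEnd (t *: ad L u).
  by congr expEnd; apply/lfunP=> v; rewrite !lfunE /= lfunE /= lieZl.
rewrite expEnd_rotation => [|v]; first by rewrite !adE.
rewrite !adE; have [a [b [c [d ->]]]] := frame_span v.
by rewrite !lie_frame frameN; congr frame; ring.
Qed.

Hypothesis canE : canonical_pair E.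

(** A rotation by th + pi with th = atan b sends g4 to a multiple of
k = a e1 + b e2 + g4 modulo e1. *)
Lemma isotopic_trivial a b : env_sub E = <[frame a b 0 1]>%VS ->
  bol_iii (line_bol 0 0 0) /\ isotopic B (line_bol 0 0 0).
Proof.
move=> hE; split; first by exists e1, e2, e3; split=> //; exact: line_bol0_mul.
set th := atan b; have cth : 0 < cos th.
  by rewrite cos_atan invr_gt0 sqrtr_gt0 ltr_pwDl ?sqr_ge0.
have sth : sin th = b * cos th.
  by rewrite -{1}(atanK b) -/th /tan divfK ?gt_eqF.
(* The rotation adds z (1 - cos (th + pi)) to the coordinate on e1, and z makes
   it match that of - cos th k; the half-turn ensures 1 + cos th <> 0. *)
set z := - (a * cos th) / (1 + cos th).
apply: (@isotopic_comp_bol _ _ _ _ _ _ _ _ ((th + pi) *: frame 0 0 1 z) canE).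
  exact: line_core.
rewrite limg_line hE Ad_rotation !lie_frame !(frameZ, frameD) sinDpi cosDpi sth.
set k := frame _ _ _ _.
have -> : k = - cos th *: frame a b 0 1.
  rewrite frameZ; congr frame; try ring.
  by rewrite /z; field; rewrite gt_eqF // addr_gt0.
by rewrite lineZ // oppr_eq0 gt_eqF.
Qed.

(** The half-turn is 1 + 2 (ad u)^2, where u = (b / 2) e2 + e3 + g4 is the midpoint
of the generators e3 + g4 and b e2 + e3 + g4 modulo e1. *)
Lemma isotopic_i b : env_sub E = <[frame (- (b ^+ 2 / 2)) b 1 1]>%VS ->
  bol_i (line_bol 0 0 1) /\ isotopic B (line_bol 0 0 1).
Proof.
move=> hE; split.
  exists e1, e2, e3; split=> //; have := line_bol_table 0 0 1.
  by rewrite !scale0r !add0r scale1r.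
apply: (@isotopic_comp_bol _ _ _ _ _ _ _ _ (pi *: frame 0 (b / 2) 1 1) canE).
  exact: line_core.
rewrite limg_line hE Ad_rotation !lie_frame !(frameZ, frameD) sinpi cospi.
by congr <[_]>%VS; congr frame; field.
Qed.

(** The coordinates attached to the bases of [tri_Vplus_rescale]. *)
Lemma frame_rescale s t a b c d :
  let f1 := s ^+ 2 *: e1 in let f2 := s *: e2 in let f3 := e3 + t *: e1 in
  i (a *: f1 + b *: f2 + c *: f3) + d *: lie L (i f2) (i f3) =
  frame (a * s ^+ 2 + c * t) (b * s) c (d * s).
Proof.
move=> f1 f2 f3; have -> : lie L (i f2) (i f3) = s *: g4.
  rewrite /f2 /f3 linearZ lieZl linearD linearZ /= lieDr lieZr.
  by rewrite (lie_anti L (i e2) (i e1)) lie_frame12 oppr0 scaler0 addr0.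
rewrite /frame; congr (i _ + _); last by rewrite scalerA.
rewrite /f1 /f2 /f3 scalerDr !scalerA scalerDl.
by rewrite [c *: e3 + _]addrC !addrA [_ + (c * t) *: e1]addrAC.
Qed.

End Envelope.

Theorem mainTheorem4 (R : realType) (V : vectType R) (B : bolAlgebra V)
  (dimB : \dim {:V} = 3%N) (triB : type_Vplus B)
  (E : envelopingPair B) (canE : canonical_pair E)
  (dimG : \dim {:env_space E} = 4%N) :
  exists (W : vectType R) (B' : bolAlgebra W),
    (bol_i B' \/ bol_ii B' \/ bol_iii B') /\ isotopic B B'.
Proof.
have [e1 [e2 [e3 [base tri]]]] := triB.
have [a [b [c hE]]] := env_sub_line base tri dimB dimG.
have [c0|c0] := eqVneq c 0.
  rewrite c0 in hE.
  have [iii iso] := isotopic_trivial base tri dimB dimG canE hE.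
  by exists V, (line_bol base tri dimB dimG 0 0 0); split=> //; right; right.
(* s times the generator of h has coordinate 1 on e3 + t e1, and t is chosen for
   its coordinate on s^2 e1 to be - b^2 / 2. *)
pose s := c^-1; have s0 : s != 0 by rewrite invr_eq0.
pose t := s * a + b ^+ 2 / 2 * s ^+ 2.
have [fbase ftri] := tri_Vplus_rescale base tri t dimB s0.
have hE' : env_sub E =
    <[frame E (s ^+ 2 *: e1) (s *: e2) (e3 + t *: e1)
        (- (b ^+ 2 / 2)) b 1 1]>%VS.
  rewrite {1}/frame frame_rescale // hE -[LHS](lineZ _ s0) frameZ.
  by congr <[_]>%VS; congr frame; rewrite /t /s; field.
have [itab iso] := isotopic_i fbase ftri dimB dimG canE hE'.
by exists V, (line_bol fbase ftri dimB dimG 0 0 1); split=> //; left.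
Qed.
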